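(* Let $n\geq 2$ be an integer. Then $$\gamma^{\mathrm{ID}}_{D}(\mathcal P_{2,n})=\begin{cases}\left\lceil\frac{n+1}{2}\right\rceil+1 & \text{if } n\in\{2,3,4,5,7\},\\ \left\lceil\frac{n+1}{2}\right\rceil & \text{otherwise.}\end{cases}$$
   Context: For integers $m,n\geq1$, $\mathcal P_{m,n}$ denotes the set of points $(x,y)\in\mathbb Z^2$ with $1\leq y\leq m$ and $1\leq x\leq n$. A disk of radius $r>0$ and center $c\in\mathbb R^2$ is the set of points of $\mathbb R^2$ at Euclidean distance at most $r$ from $c$. A point is covered by a disk if it belongs to it; two points are separated by a disk if exactly one of them is covered by it. A set $\mathcal D$ of disks identifies a finite set $\mathcal P\subseteq\mathbb R^2$ if every point of $\mathcal P$ is covered by some disk of $\mathcal D$ and every pair of distinct points of $\mathcal P$ is separated by some disk of $\mathcal D$. $\gamma^{\mathrm{ID}}_{D}(\mathcal P)$ denotes the minimum number of disks (of arbitrary radii) in a set identifying $\mathcal P$. *)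

(* Defs.v *)
From mathcomp Require Import all_boot all_order all_algebra.
From mathcomp Require Import boolp classical_sets functions cardinality reals.

Set Implicit Arguments.
Unset Strict Implicit.
Unset Printing Implicit Defensive.

Import Order.TTheory GRing.Theory Num.Theory.

Local Open Scope classical_set_scope.
Local Open Scope ring_scope.
Local Open Scope card_scope.

(* The norm that the library puts on [R * R] is the maximum norm. *)
Definition edist {R : realType} (p q : R * R) : R :=
  Num.sqrt ((p.1 - q.1) ^+ 2 + (p.2 - q.2) ^+ 2).

Definition disk {R : realType} (c : R * R) (r : R) : set (R * R) :=
  [set p | edist p c <= r].

Definition is_disk {R : realType} (B : set (R * R)) : Prop :=
  exists (c : R * R) (r : R), 0 < r /\ B = disk c r.

Definition separates {R : realType} (B : set (R * R)) (p q : R * R) : Prop :=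
  (B p /\ ~ B q) \/ (~ B p /\ B q).

Definition identifies {R : realType} (D : set (set (R * R)))
    (P : set (R * R)) : Prop :=
  (forall p, P p -> exists B, D B /\ B p) /\
  (forall p q, P p -> P q -> p <> q -> exists B, D B /\ separates B p q).

Definition identifiable_with {R : realType} (P : set (R * R)) (k : nat) : Prop :=
  exists D : set (set (R * R)),
    [/\ (forall B, D B -> is_disk B), D #= `I_k & identifies D P].

(* The default value 0 is taken only when no finite set of disks identifies
   [P]; otherwise the minimum exists and is unique.  A nonempty [P] is never
   identified by 0 disks, so for such [P] a positive value is the minimum. *)
Definition gammaID {R : realType} (P : set (R * R)) : nat :=
  xget 0%N [set k : nat | identifiable_with P k /\
                          forall j : nat, identifiable_with P j -> (k <= j)%N].

(* [m] rows and [n] columns: the first coordinate ranges over 1..n and the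
   second one over 1..m. *)
Definition grid (R : realType) (m n : nat) : set (R * R) :=
  [set p | exists x y : int,
     [/\ 1 <= y <= m%:Z, 1 <= x <= n%:Z & p = (x%:~R, y%:~R)]].
Arguments grid : clear implicits.

(* Main.v *)
(* A disk meets the two rows of the grid in two concentric intervals, the one of
   the row closer to its center containing the other, and all pairs of
   concentric intervals occur.

   Lower bound.  Add an uncovered column at each end.  In one row, each of the
   n + 1 pairs of consecutive points must be separated, and a disk separates at
   most two of them, so k disks give n + 1 <= 2k; also 2n <= 2^k - 1, as the
   points are covered by distinct nonempty sets of disks.  For n = 7 and k = 4
   the first bound is tight: from a column to the next exactly one disk changes
   in each row.  Sweeping the columns from left to right, distinctness of the
   covering sets and nestedness of the two traces of each disk leave no
   possibility for the sixth column.

   Upper bound.  An identifying family for n columns also works for fewer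
   columns, so it suffices to identify 3 columns with 3 disks, 6 with 4, and
   2k - 1 with k for every k >= 5.  In the last case each of the 2k gaps of a
   row is the end of exactly one trace. *)

Require Import Defs.
From mathcomp Require Import all_boot all_order all_algebra.
From mathcomp Require Import boolp classical_sets functions cardinality reals.
From mathcomp Require Import zify ring lra.

Set Implicit Arguments.
Unset Strict Implicit.
Unset Printing Implicit Defensive.

Import Order.TTheory GRing.Theory Num.Theory.

(** * Codes of nested intervals and their counting bounds *)

(* [m i y x] says that the [i]-th disk covers the point of column [x] in the
   first ([y = false]) or second ([y = true]) row. *)
Record nested_code (k n : nat) (m : 'I_k -> bool -> nat -> bool) : Prop := {
  code_convex : forall i y x1 x2 x3,
    x1 <= x2 <= x3 -> m i y x1 -> m i y x3 -> m i y x2;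
  code_support : forall i y x, m i y x -> 1 <= x <= n;
  code_cover : forall y x, 1 <= x <= n -> exists i, m i y x;
  code_inj : forall y x y' x', 1 <= x <= n -> 1 <= x' <= n ->
    (forall i, m i y x = m i y' x') -> (y, x) = (y', x');
  code_nested : forall i, exists y, forall x, m i y x -> m i (~~ y) x }.

Section NestedCode.
Variables (k n : nat) (m : 'I_k -> bool -> nat -> bool).
Hypothesis mP : nested_code n m.
Hypothesis n0 : 0 < n.

Lemma code_size_exp : 2 * n < 2 ^ k.
Proof.
(* [None] stands for an uncovered point, so covering becomes part of injectivity. *)
pose S (p : option (bool * 'I_n)) : {ffun 'I_k -> bool} :=
  [ffun i => if p is Some (y, x) then m i y x.+1 else false].
have S0 y (x : 'I_n) : S (Some (y, x)) <> S None.
  have [i mi] : exists i, m i y x.+1 by apply: (code_cover mP); rewrite ltn_ord.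
  by move/ffunP/(_ i); rewrite !ffunE mi.
have S_inj : injective S.
  move=> [[y x]|] [[y' x']|] // eS.
  - suff: (y, x.+1) = (y', x'.+1) by case=> -> /val_inj ->.
    apply: (code_inj mP) => [||i]; rewrite ?ltn_ord //.
    by have /ffunP/(_ i) := eS; rewrite !ffunE.
  - by case: (S0 y x).
  - by case: (S0 y' x').
have := leq_card S S_inj.
by rewrite card_option card_prod card_ffun !card_bool !card_ord.
Qed.

(* For [x = 0] and [x = n] one of the two columns is empty. *)
Definition toggles i y x := m i y x != m i y x.+1.

Lemma code_toggles y x : x <= n -> exists i, toggles i y x.
Proof.
move=> xn; have out i z : ~~ (1 <= z <= n) -> m i y z = false.
  by move=> hz; apply/negP => /(code_support mP); apply/negP.
case: (posnP x) => [->|x0].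
  have [i mi] := code_cover mP y (n0 : 1 <= 1 <= n).
  by exists i; rewrite /toggles mi out.
have [xn'|xn'] := ltnP x n; last first.
  have [i mi] : exists i, m i y x by apply: (code_cover mP); rewrite x0 xn.
  by exists i; rewrite /toggles mi out //; lia.
apply/existsP; apply: contraT; rewrite negb_exists => /forallP h.
have [] : (y, x) = (y, x.+1); last by lia.
by apply: (code_inj mP) => [||i]; [lia|lia|apply/eqP; have := h i; rewrite negbK].
Qed.

(** By convexity a disk enters a row once and leaves it once; the value [m i y x] tells which of the
    two occurs. *)
Lemma toggles_inj i y x x' : toggles i y x -> toggles i y x' ->
  m i y x = m i y x' -> x = x'.
Proof.
wlog lt_xx' : x x' / x < x' => [th tx tx' e|].
  by case: (ltngtP x x') => // lt; [|symmetry]; apply: th.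
rewrite /toggles => tx tx' e; exfalso; move: tx tx'; rewrite -e.
have c z1 z2 z3 := @code_convex _ _ _ mP i y z1 z2 z3.
case mx: (m i y x) => /=.
- move: e; rewrite mx => /esym mx'; rewrite (c x x.+1 x') //; lia.
- move: e; rewrite mx => /esym mx' /negPf/negbFE m1 /negPf/negbFE m2.
  by move: mx'; rewrite (c x.+1 x' x'.+1) //; lia.
Qed.

Lemma code_toggle_fun y : exists f : 'I_n.+1 -> 'I_k,
  (forall x : 'I_n.+1, toggles (f x) y x) /\
  injective (fun x : 'I_n.+1 => (f x, m (f x) y x)).
Proof.
have [x|f fP] := @fin_all_exists _ (fun=> 'I_k) (fun x i => toggles i y (x : 'I_n.+1)).
  by apply: code_toggles; rewrite -ltnS.
exists f; split=> // x x' [ef em]; apply/val_inj.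
apply: (toggles_inj (fP x)); first by rewrite ef; exact: fP.
by rewrite em ef.
Qed.

Lemma code_size_lin : n.+1 <= 2 * k.
Proof.
have [f [_ /leq_card]] := code_toggle_fun true.
by rewrite card_prod card_bool !card_ord mulnC.
Qed.

(** In the tight case the injection from gaps to pairs (disk, direction) is onto, so every change is
    the one chosen for its gap. *)
Lemma toggles_uniq y x i j : n.+1 = 2 * k -> x <= n ->
  toggles i y x -> toggles j y x -> i = j.
Proof.
move=> tight xn ti tj; have [f [fP f_inj]] := code_toggle_fun y.
have f_onto p : exists x', p = (f x', m (f x') y (x' : 'I_n.+1)).
  have [] := inj_card_bij f_inj _; last by move=> g _ gK; exists (g p); rewrite gK.
  by rewrite card_prod card_bool !card_ord tight mulnC.
pose x0 : 'I_n.+1 := Ordinal (xn : x < n.+1).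
suff eqf i' : toggles i' y x -> i' = f x0 by rewrite (eqf i ti) (eqf j tj).
move=> ti'; have [x' [fx' mx']] := f_onto (i', m i' y x).
have tx' : toggles i' y x' by rewrite fx'.
rewrite fx'; congr f; apply/val_inj => /=; symmetry.
by apply: (toggles_inj ti' tx'); rewrite mx' fx'.
Qed.

End NestedCode.

(** * Seven columns and four disks: exhaustive sweep *)

(* The sets of disks, out of 4, that cover the two points of a column. *)
Definition column : Type := seq bool * seq bool.

Definition row (p : column) (y : bool) : seq bool := if y then p.2 else p.1.

Definition flip (j : nat) (s : seq bool) : seq bool :=
  mkseq (fun z => nth false s z (+) (z == j)) 4.

Definition empty_column : column := (nseq 4 false, nseq 4 false).

(* The columns of a sweep [h] are listed from the last one to the first one. *)
Definition admissible (h : seq column) : bool :=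
  uniq (nseq 4 false :: [seq row p y | p <- h, y <- [:: false; true]]) &&
  all (fun i => has (fun y =>
    all (fun p => nth false (row p y) i ==> nth false (row p (~~ y)) i) h)
    [:: false; true]) (iota 0 4).

(** Since 7 + 1 = 2 * 4, [toggles_uniq] leaves exactly one flip per row. *)
Definition successors (p : column) : seq column :=
  [seq (flip i p.1, flip j p.2) | i <- iota 0 4, j <- iota 0 4].

(** [admissible] passes to sweeps with fewer columns, so pruning loses none. The default of [head]
    is the uncovered column 0. *)
Definition extend (H : seq (seq column)) : seq (seq column) :=
  [seq h <- [seq p :: h | h <- H, p <- successors (head empty_column h)] |
    admissible h].

Lemma no_sweep6 : iter 6 extend [:: [::]] = [::].
Proof. by vm_compute. Qed.

Lemma no_nested_code_7_4 (m : 'I_4 -> bool -> nat -> bool) : ~ nested_code 7 m.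
Proof.
move=> mP.
pose w x : column :=
  (mkseq (fun z => m (inord z) false x) 4, mkseq (fun z => m (inord z) true x) 4).
have wE x y : row (w x) y = mkseq (fun z => m (inord z) y x) 4 by case: y.
have nth_w x y (i : 'I_4) : nth false (row (w x) y) i = m i y x.
  by rewrite wE nth_mkseq ?inord_val.
have w0 : w 0 = empty_column.
  have m0 i y : m i y 0 = false by apply/negP => /(code_support mP).
  by rewrite /w /mkseq /= !m0.
have w_flip x y : x <= 7 ->
    exists2 j, j \in iota 0 4 & row (w x.+1) y = flip j (row (w x) y).
  move=> x7; have [i ti] := code_toggles mP isT y x7.
  exists (i : nat); first by rewrite mem_iota ltn_ord.
  rewrite wE; apply/eq_in_map => z; rewrite mem_iota /= => z4.
  have -> : (z == i) = (inord z == i :> 'I_4) by rewrite -val_eqE /= inordK.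
  rewrite -{2}(inordK z4) nth_w.
  have [zi|zi] := eqVneq (inord z) i.
    by move: ti; rewrite -zi /toggles; case: (m _ _ x) (m _ _ x.+1) => [] [].
  rewrite addbF; apply/eqP; apply: contraNT zi => /eqP tz; apply/eqP.
  by apply: (toggles_uniq mP) ti => //; rewrite /toggles eq_sym; apply/eqP.
have w_inj x y x' y' : 1 <= x <= 7 -> 1 <= x' <= 7 ->
    row (w x) y = row (w x') y' -> (x, y) = (x', y').
  move=> hx hx' e; suff [-> ->] : (y, x) = (y', x') by [].
  by apply: (code_inj mP) => // i; rewrite -!nth_w e.
have w_cover x y : 1 <= x <= 7 -> row (w x) y <> nseq 4 false.
  move=> hx e; have [i] := code_cover mP y hx.
  by rewrite -nth_w e nth_nseq; case: ifP.
pose hist x := [seq w z | z <- rev (iota 1 x)].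
have hist_ok x : x <= 7 -> admissible (hist x).
  move=> x7; have mem_hist z : z \in rev (iota 1 x) -> 1 <= z <= 7.
    by rewrite mem_rev mem_iota; lia.
  apply/andP; split; last first.
    apply/allP => i; rewrite mem_iota => /andP[_ i4].
    have [y yP] := code_nested mP (Ordinal i4).
    apply/hasP; exists y; first by case: (y).
    apply/allP => _ /mapP[z _ ->]; apply/implyP.
    by have := yP z; rewrite -!nth_w.
  rewrite allpairs_mapl cons_uniq; apply/andP; split.
    apply/negP => /allpairsPdep[z [y [/mem_hist hz _ /esym]]]; exact: w_cover.
  apply: allpairs_uniq; rewrite ?rev_uniq ?iota_uniq //.
  move=> [z y] [z' y'] /allpairsPdep[? [? [/mem_hist hz _ [-> ->]]]].
  move=> /allpairsPdep[? [? [/mem_hist hz' _ [-> ->]]]]; exact: w_inj.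
have histS x : hist x.+1 = w x.+1 :: hist x.
  by rewrite /hist -(addn1 x) iotaD rev_cat /= add1n addn1.
have hist_ext x : x <= 7 -> hist x \in iter x extend [:: [::]].
  elim: x => [|x IH] x7 //.
  rewrite iterS mem_filter hist_ok // histS.
  apply/allpairsPdep; exists (hist x), (w x.+1); split=> //; first exact/IH/ltnW.
  have -> : head empty_column (hist x) = w x.
    case: (x) => [|z]; first by rewrite w0.
    by rewrite histS.
  have [i i4 fi] := w_flip x false (ltnW x7).
  have [j j4 fj] := w_flip x true (ltnW x7).
  by apply/allpairsP; exists (i, j); split=> //; rewrite -fi -fj.
by have := hist_ext 6 isT; rewrite no_sweep6.
Qed.

(** * Explicit families of traces *)

(* [(s, h0, h1)] stands for the disk whose center has abscissa [s / 4] and whose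
   traces on the two rows have half-lengths [h0 / 4] and [h1 / 4].  Halves would
   not suffice for the disk [k.-1] of [tracesk]. *)
Definition trace (u : nat * nat * nat) (y : bool) (x : nat) : bool :=
  let h := if y then u.2 else u.1.2 in
  (4 * x <= u.1.1 + h) && (u.1.1 <= 4 * x + h).

Definition traces_identify (n k : nat) (u : nat -> nat * nat * nat) : Prop :=
  (forall y x, 1 <= x <= n -> exists2 i, i < k & trace (u i) y x) /\
  (forall y x y' x', 1 <= x <= n -> 1 <= x' <= n ->
    (forall i, i < k -> trace (u i) y x = trace (u i) y' x') ->
    (y, x) = (y', x')).

Lemma traces_identifyW n n' k u :
  n' <= n -> traces_identify n k u -> traces_identify n' k u.
Proof.
move=> le_n' [cov inj].
have sub x : 1 <= x <= n' -> (1 <= x <= n) by lia.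
by split=> [y x /sub|y x y' x' /sub hx /sub hx']; [exact: cov|exact: inj].
Qed.

(** Columns covered in the two rows: none and [1,3]; [1,2] and [1,1]; [2,3] and [2,2]. *)
Definition traces3 (i : nat) : nat * nat * nat :=
  nth (0, 0, 0) [:: (2, 0, 10); (4, 4, 0); (9, 3, 1)] i.

(** Columns covered in the two rows: [1,1] and [1,4]; [1,5] and [2,2]; [3,4] and [2,6]; [4,6] and
    [4,5]. *)
Definition traces6 (i : nat) : nat * nat * nat :=
  nth (0, 0, 0) [:: (4, 0, 12); (8, 12, 0); (15, 3, 9); (19, 5, 3)] i.

(* The covered columns of the first and second row are
     [i = 0]            [1, 2k-3]       and  [k-2, k],
     [i = k-1]          [3, 2k-1]       and  [k, k+1],
     [i = 1]            [2, k-1]        and  [1, k+2],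
     [i = k-2]          [k+1, 2k-2]     and  [k-1, 2k-1],
     [2 <= i <= k-3]    [i+2, i+k-1]    and  [i, i+k+1]. *)
Definition tracesk (k i : nat) : nat * nat * nat :=
  if i == 0 then (4 * k - 4, 4 * k - 8, 4)
  else if i == k.-1 then (4 * k + 3, 4 * k - 7, 3)
  else if i == 1 then (2 * k + 2, 2 * k - 6, 2 * k + 6)
  else if i == k - 2 then (6 * k - 2, 2 * k - 6, 2 * k + 2)
  else (4 * i + 2 * k + 2, 2 * k - 6, 2 * k + 2).

Lemma traces3_identify : traces_identify 3 3 traces3.
Proof.
split=> [y x hx|y x y' x' hx hx' e].
  suff : has (fun i => trace (traces3 i) y x) (iota 0 3).
    by case/hasP => i; rewrite mem_iota; exists i.
  by case: y; move: x hx => [|[|[|[|?]]]].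
move: (e 0 isT) (e 1 isT) (e 2 isT); move: hx hx' {e}.
by case: y y' => [] []; move: x x' => [|[|[|[|x]]]] [|[|[|[|x']]]].
Qed.

Lemma traces6_identify : traces_identify 6 4 traces6.
Proof.
split=> [y x hx|y x y' x' hx hx' e].
  suff : has (fun i => trace (traces6 i) y x) (iota 0 4).
    by case/hasP => i; rewrite mem_iota; exists i.
  by case: y; move: x hx => [|[|[|[|[|[|[|?]]]]]]].
move: (e 0 isT) (e 1 isT) (e 2 isT) (e 3 isT); move: hx hx' {e}.
by case: y y' => [] []; move: x x' => [|[|[|[|[|[|[|x]]]]]]] [|[|[|[|[|[|[|x']]]]]]].
Qed.

Lemma tracesk_identify k : 5 <= k -> traces_identify (2 * k - 1) k (tracesk k).
Proof.
move=> k5.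
have t0 y x : 1 <= x <= 2 * k - 1 -> trace (tracesk k 0) y x =
    if y then (k - 2 <= x <= k) else x <= 2 * k - 3.
  by rewrite /trace /tracesk /=; case: y => /=; lia.
have tl y x : 1 <= x <= 2 * k - 1 -> trace (tracesk k k.-1) y x =
    if y then (k <= x <= k.+1) else (3 <= x).
  have -> : tracesk k k.-1 = (4 * k + 3, 4 * k - 7, 3).
    by rewrite /tracesk eqxx ifF //; lia.
  by rewrite /trace; case: y => /=; lia.
have t1 y x : 1 <= x <= 2 * k - 1 -> trace (tracesk k 1) y x =
    if y then (x <= k.+2) else (2 <= x <= k.-1).
  have -> : tracesk k 1 = (2 * k + 2, 2 * k - 6, 2 * k + 6).
    by rewrite /tracesk /= ifF //; lia.
  by rewrite /trace; case: y => /=; lia.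
have tr y x : 1 <= x <= 2 * k - 1 -> trace (tracesk k (k - 2)) y x =
    if y then k.-1 <= x else (k.+1 <= x <= 2 * k - 2).
  have -> : tracesk k (k - 2) = (6 * k - 2, 2 * k - 6, 2 * k + 2).
    by rewrite /tracesk eqxx !ifF //; lia.
  by rewrite /trace; case: y => /=; lia.
have tm i y x : 2 <= i <= k - 3 -> 1 <= x <= 2 * k - 1 ->
    trace (tracesk k i) y x =
    if y then (i <= x <= i + k + 1) else (i + 2 <= x <= i + k - 1).
  move=> hi; have -> : tracesk k i = (4 * i + 2 * k + 2, 2 * k - 6, 2 * k + 2).
    by rewrite /tracesk !ifF //; lia.
  by rewrite /trace; case: y => /=; lia.
split=> [[] x hx|].
- have [h|h] := leqP x k.+2; [exists 1|exists (k - 2)]; try by lia.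
  + by rewrite t1.
  + by rewrite tr //; lia.
- have [h|h] := leqP x (2 * k - 3); [exists 0|exists k.-1]; try by lia.
  + by rewrite t0.
  + by rewrite tl //; lia.
pose same y x y' x' := forall i, i < k ->
  trace (tracesk k i) y x = trace (tracesk k i) y' x'.
(* Each first-row column lies in the trace of disk 0 or [k.-1], which puts [x] in [k-2, k+1]; disks
   1, [k - 2] and 2 then give a contradiction. *)
have cross x x' : 1 <= x <= 2 * k - 1 -> 1 <= x' <= 2 * k - 1 ->
    same true x false x' -> False.
  move=> hx hx' e; have := e 0; have := e k.-1; have := e 1.
  have := e (k - 2); have := e 2.
  by rewrite !t0 // !tl // !t1 // !tr // !tm //; lia.
have same_row y x x' : 1 <= x -> x < x' -> x' <= 2 * k - 1 ->
    same y x y x' -> False.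
  move=> x1 xx' x'n e.
  have hx : (1 <= x <= 2 * k - 1) by lia.
  have hx' : (1 <= x' <= 2 * k - 1) by lia.
  have em i : 2 <= i <= k - 3 -> trace (tracesk k i) y x = trace (tracesk k i) y x'.
    by move=> hi; apply: e; lia.
  have := e 0; have := e k.-1; have := e 1; have := e (k - 2).
  rewrite !t0 // !tl // !t1 // !tr //; case: y {e} em => em er e1 el e0.
  (* Try the middle disk whose trace begins at [x.+1], then the one whose trace ends at [x]. If [x']
     lies beyond the former trace, disk 1 covers [x] but not [x']. *)
  - have [h|h] := boolP (2 <= x.+1 <= k - 3).
      by have := em _ h; rewrite !tm //; lia.
    have [h'|h'] := boolP (2 <= x - k.+1 <= k - 3).
      by have := em _ h'; rewrite !tm //; lia.
    lia.
  - have [h|h] := boolP (2 <= x.-1 <= k - 3).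
      by have := em _ h; rewrite !tm //; lia.
    have [h'|h'] := boolP (2 <= x.+1 - k <= k - 3).
      by have := em _ h'; rewrite !tm //; lia.
    lia.
move=> y x y' x' hx hx' e.
case: y y' e => [] [] e.
- case: (ltngtP x x') => [xx'|xx'|-> //]; exfalso.
    by apply: (same_row true x x') => //; lia.
  by apply: (same_row true x' x) => //; [lia|lia|move=> i ik; rewrite e].
- by case: (cross x x').
- by case: (cross x' x) => // i ik; rewrite e.
- case: (ltngtP x x') => [xx'|xx'|-> //]; exfalso.
    by apply: (same_row false x x') => //; lia.
  by apply: (same_row false x' x) => //; [lia|lia|move=> i ik; rewrite e].
Qed.

(** * Traces of Euclidean disks on the grid *)

Local Open Scope ring_scope.

Definition pt (R : realType) (y : bool) (x : nat) : R * R :=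
  (x%:R, y.+1%:R).
Arguments pt : clear implicits.

Lemma grid2P (R : realType) (n : nat) (p : R * R) :
  grid R 2 n p <-> exists y x, (1 <= x <= n)%N /\ p = pt R y x.
Proof.
split.
  case=> x [y [y12 x1n ->]]; case: x x1n => [x|x] x1n; last by lia.
  exists (y == 2), x; split; first by lia.
  rewrite /pt; congr pair; rewrite -[RHS]/((y == 2).+1%:~R); congr intmul.
  by case: eqP; lia.
case=> y [x [x1n ->]]; exists x%:Z, y.+1%:Z; split=> //.
by case: y.
Qed.

Lemma pt_inj (R : realType) y x y' x' :
  pt R y x = pt R y' x' -> (y, x) = (y', x').
Proof.
case=> /eqP; rewrite eqr_nat => /eqP -> /eqP.
by rewrite eqr_nat; case: y y' => [] [].
Qed.

Section DiskTraces.
Variable R : realType.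
Implicit Types (B : set (R * R)) (c p : R * R) (r : R) (x n k : nat).

Lemma diskE c r p : 0 < r ->
  disk c r p <-> (p.1 - c.1) ^+ 2 + (p.2 - c.2) ^+ 2 <= r ^+ 2.
Proof.
move=> r0; rewrite -(ler_sqrt (_ + _)) ?sqr_ge0 //.
by rewrite sqrtr_sqr (gtr0_norm r0).
Qed.

Lemma disk_convex B y x1 x2 x3 : is_disk B -> (x1 <= x2 <= x3)%N ->
  B (pt R y x1) -> B (pt R y x3) -> B (pt R y x2).
Proof.
case=> c [r [r0 ->]] /andP[]; rewrite -!(ler_nat R) => h12 h23.
rewrite !diskE //=; set t := (_ - c.2) ^+ 2.
case: (lerP x2%:R c.1) => h h1 h3; nra.
Qed.

Lemma disk_nested B : is_disk B ->
  exists y, forall x, B (pt R y x) -> B (pt R (~~ y) x).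
Proof.
case=> c [r [r0 ->]].
have [h|h] := lerP ((1 - c.2) ^+ 2) ((2%:R - c.2) ^+ 2).
  by exists true => x; rewrite !diskE //=; apply: le_trans; rewrite lerD2l.
exists false => x; rewrite !diskE //=; apply: le_trans; rewrite lerD2l; exact: ltW.
Qed.

Lemma disk_of_trace u : exists B,
  is_disk B /\ forall y x, B (pt R y x) <-> trace u y x.
Proof.
case: u => [[s h0] h1].
pose a : R := h0%:R / 4; pose b : R := h1%:R / 4.
have a0 : 0 <= a by rewrite divr_ge0.
have b0 : 0 <= b by rewrite divr_ge0.
(* The ordinate that makes the two traces have half-lengths [a] and [b]. *)
pose v := (3 - (a ^+ 2 - b ^+ 2)) / 2.
pose q := a ^+ 2 + (1 - v) ^+ 2.
have qE : q = b ^+ 2 + (2 - v) ^+ 2 by rewrite /q /v; field.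
(* The center is off one of the two rows, so the radius is positive even for zero half-lengths. *)
have q0 : 0 < q.
  have [v1|v1] := eqVneq v 1; last first.
    by apply: ltr_wpDl; rewrite ?sqr_ge0 // exprn_even_gt0 //= subr_eq0 eq_sym.
  by rewrite qE v1; apply: ltr_wpDl; rewrite ?sqr_ge0 //; lra.
have rowE x (h : nat) : (`|x%:R - s%:R / 4| <= h%:R / 4 :> R) =
    ((4 * x <= s + h) && (s <= 4 * x + h))%N.
  rewrite -!(ler_nat R) !(natrD, natrM) ler_norml; apply/andP/andP => -[? ?]; split; lra.
exists (disk (s%:R / 4, v) (Num.sqrt q)); split.
  by exists (s%:R / 4, v), (Num.sqrt q); rewrite sqrtr_gt0.
move=> y x; rewrite diskE ?sqrtr_gt0 // sqr_sqrtr ?(ltW q0) //= /trace /=.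
case: y => /=; rewrite -rowE.
  by rewrite qE lerD2r -ler_sqrt ?sqr_ge0 // !sqrtr_sqr [`|b|]ger0_norm.
by rewrite lerD2r -ler_sqrt ?sqr_ge0 // !sqrtr_sqr [`|a|]ger0_norm.
Qed.

End DiskTraces.

(** * From disks to codes and back; the minimum *)

Lemma identifiable_code (R : realType) (n k : nat) :
  identifiable_with (grid R 2 n) k ->
  exists m : 'I_k -> bool -> nat -> bool, nested_code n m.
Proof.
case=> D [Ddisk]; rewrite card_eq_sym => /card_set_bijP[f [fD _ f_onto]] [cov sep].
have f_disk (i : 'I_k) : is_disk (f i) by apply: Ddisk; apply: fD => /=.
(* Disks may reach beyond the grid; truncation gives [code_support]. *)
exists (fun i y x => (1 <= x <= n)%N && `[< f i (pt R y x) >]).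
have on_grid y x : (1 <= x <= n)%N -> grid R 2 n (pt R y x).
  by move=> hx; apply/grid2P; exists y, x.
have D_f B : D B -> exists i : 'I_k, B = f i.
  by move=> /f_onto[i ik <-]; exists (Ordinal (ik : i < k)%N).
split.
- move=> i y x1 x2 x3 h /andP[h1 /asboolP f1] /andP[h3 /asboolP f3].
  apply/andP; split; first by lia.
  exact/asboolP/(disk_convex (f_disk i) h).
- by move=> i y x /andP[].
- move=> y x hx; have [B [/D_f[i ->] Bp]] := cov _ (on_grid y x hx).
  by exists i; rewrite hx; apply/asboolP.
- move=> y x y' x' hx hx' e; apply: contrapT => ne.
  have [] := sep _ _ (on_grid y x hx) (on_grid y' x' hx').
    by move/pt_inj.
  move=> _ [/D_f[i ->]]; have := e i; rewrite hx hx' /= /separates.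
  by case: asboolP; case: asboolP => //; tauto.
- move=> i; have [y yP] := disk_nested (f_disk i); exists y => x.
  by case/andP=> -> /asboolP/yP/asboolP.
Qed.

(** Only [j <= k] is claimed, since distinct indices may yield the same disk. *)
Lemma identifiable_traces (R : realType) (n k : nat) (u : nat -> nat * nat * nat) :
  traces_identify n k u -> exists2 j, (j <= k)%N & identifiable_with (grid R 2 n) j.
Proof.
move=> [cov inj].
have [f fP] := choice (fun i => disk_of_trace R (u i)).
pose D := [set f i | i in `I_k]%classic.
have [j Dj] : finite_set D by apply: finite_image; exact: finite_II.
exists j.
  by have := card_image_le f `I_k; rewrite -/D (card_le_eql Dj) card_le_II.
exists D; split=> //.
  by move=> _ [i _ <-]; case: (fP i).
split.
  move=> _ /grid2P[y [x [hx ->]]]; have [i ik ti] := cov y x hx.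
  by exists (f i); split; [exists i|apply/(fP i).2].
move=> _ _ /grid2P[y [x [hx ->]]] /grid2P[y' [x' [hx' ->]]] ne.
apply: contrapT => nsep; apply: ne; suff [-> ->] : (y, x) = (y', x') by [].
apply: inj => // i ik; apply/idP/idP => h; apply: contrapT => h'; apply: nsep.
  by exists (f i); split; [exists i|left; split; rewrite (fP i).2].
by exists (f i); split; [exists i|right; split; rewrite (fP i).2].
Qed.

Lemma gammaID_eq (R : realType) (P : set (R * R)) (k : nat) :
  (exists2 j, (j <= k)%N & identifiable_with P j) ->
  (forall j, identifiable_with P j -> (k <= j)%N) -> gammaID P = k.
Proof.
move=> [j jk jP] k_min; have ejk : j = k by apply/eqP; rewrite eqn_leq jk k_min.
apply: xget_unique => /=; first by split; [rewrite -ejk|].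
by move=> i [iP i_min]; apply/eqP; rewrite eqn_leq k_min // i_min // -ejk.
Qed.

Lemma ceil_half (R : realType) (n : nat) :
  Num.ceil ((n%:R + 1) / 2 : R) = (n.+2)./2%:Z.
Proof.
apply: ceil_def; set h := n.+2./2.
have: (2 * h <= n + 2)%N by lia.
have: (n + 1 <= 2 * h)%N by lia.
rewrite -!(ler_nat R) !(natrD, natrM) intrB -[h%:~R]/(h%:R : R) => hl hu.
apply/andP; split; lra.
Qed.

Theorem theorem4 (R : realType) (n : nat) (hn : (2 <= n)%N) :
  (gammaID (grid R 2 n))%:Z =
    if n \in [:: 2; 3; 4; 5; 7]%N
    then Num.ceil ((n%:R + 1) / 2 : R) + 1
    else Num.ceil ((n%:R + 1) / 2 : R).
Proof.
set S := [:: 2; 3; 4; 5; 7]%N.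
suff -> : gammaID (grid R 2 n) = (n.+2./2 + (n \in S))%N.
  by rewrite ceil_half; case: (n \in S); rewrite ?addn0 // PoszD.
apply: gammaID_eq.
  have [n3|n3] := leqP n 3.
    have -> : (n.+2./2 + (n \in S) = 3)%N by move: n hn n3 => [|[|[|[|]]]].
    exact: identifiable_traces (traces_identifyW n3 traces3_identify).
  have [n6|n6] := leqP n 6.
    have -> : (n.+2./2 + (n \in S) = 4)%N.
      by move: n hn n3 n6 => [|[|[|[|[|[|[|]]]]]]].
    exact: identifiable_traces (traces_identifyW n6 traces6_identify).
  apply: (@identifiable_traces _ _ _ (tracesk (n.+2./2 + (n \in S)))).
  have [n7|n7] := eqVneq n 7.
    by rewrite n7 /=; apply: traces_identifyW (tracesk_identify _).
  have nS : n \in S = false by rewrite !inE; lia.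
  by rewrite nS addn0; apply: (traces_identifyW _ (tracesk_identify _)); lia.
move=> j /identifiable_code[m mP].
have n0 : (0 < n)%N by lia.
have lin := code_size_lin mP n0; have expo := code_size_exp mP.
have n7 : n = 7 -> j <> 4.
  by move=> en ej; move: m mP {lin expo}; rewrite en ej => m /no_nested_code_7_4.
(* The exponential bound gives [3 <= j] for n >= 2 and [4 <= j] for n >= 4; it beats the linear one
   exactly for n = 2, 3, 4, 5. *)
have j3 : (j < 3)%N -> (2 ^ j <= 4)%N by move: j {m mP lin expo n7} => [|[|[|]]].
have j4 : (j < 4)%N -> (2 ^ j <= 8)%N by move: j {m mP lin expo n7 j3} => [|[|[|[|]]]].
by rewrite !inE; lia.
Qed.
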